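(* Let $E$ be a real Banach lattice with order continuous norm. Then the following are equivalent: (1) $E$ is a $KB$-space; (2) every positive compact operator $T:E\to E$ is a $KB$ operator.
   Context: A $KB$-space is a Banach lattice in which every norm-bounded increasing sequence of positive elements is norm convergent. A continuous linear operator $T:E\to E$ is called $KB$ if for every norm-bounded increasing net $(x_\alpha)_\alpha$ in $E_+$ there exists a (not necessarily unique) $x\in E$ with $\|Tx_\alpha-Tx\|\to0$. The norm of $E$ is order continuous if $\|x_\alpha\|\to0$ for every net $x_\alpha\downarrow 0$ in $E$. *)

(* Defs.v *)
From HB Require Import structures.
From mathcomp Require Import all_boot all_order all_algebra.
From mathcomp Require Import all_classical all_reals.
From mathcomp Require Import topology normedtype sequences.

Set Implicit Arguments.
Unset Strict Implicit.
Unset Printing Implicit Defensive.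

Import Order.TTheory GRing.Theory Num.Theory.
Import numFieldNormedType.Exports.

Local Open Scope classical_set_scope.
Local Open Scope ring_scope.

(* The lattice operations are fields, turned into an instance of the order
   hierarchy below, because Hierarchy Builder rejects a direct join of
   [CompleteNormedModule] and [Order.Lattice] (it would have to be declared
   before [realDomainType]).  In [blat_le_norm], the modulus of [x] is the join
   of [x] and [- x]; it is unrelated to [`|x|], which is the norm. *)
HB.mixin Record isBanachLattice (R : realType) (E : Type)
    of CompleteNormedModule R E := {
  blat_le : rel E ;
  blat_meet : E -> E -> E ;
  blat_join : E -> E -> E ;
  blat_le_refl : reflexive blat_le ;
  blat_le_anti : antisymmetric blat_le ;
  blat_le_trans : transitive blat_le ;
  blat_lexI : forall x y z : E,
    blat_le x (blat_meet y z) = blat_le x y && blat_le x z ;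
  blat_leUx : forall x y z : E,
    blat_le (blat_join x y) z = blat_le x z && blat_le y z ;
  blat_leD2r : forall x y z : E, blat_le x y -> blat_le (x + z) (y + z) ;
  blat_scale_ge0 : forall (a : R) (x : E),
    0 <= a -> blat_le 0 x -> blat_le 0 (a *: x) ;
  blat_le_norm : forall x y : E,
    blat_le (blat_join x (- x)) (blat_join y (- y)) -> `|x| <= `|y|
}.

#[short(type="banachLatticeType")]
HB.structure Definition BanachLattice (R : realType) :=
  {E of isBanachLattice R E & CompleteNormedModule R E}.

(* The display is [ring_display] so that [<=] is available in [ring_scope]. *)
HB.instance Definition _ (R : realType) (E : banachLatticeType R) :=
  Order.Le_isPOrder.Build ring_display (BanachLattice.sort E)
    (@blat_le_refl R E) (@blat_le_anti R E) (@blat_le_trans R E).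

HB.instance Definition _ (R : realType) (E : banachLatticeType R) :=
  Order.POrder_isMeetSemilattice.Build ring_display (BanachLattice.sort E)
    (@blat_lexI R E).

HB.instance Definition _ (R : realType) (E : banachLatticeType R) :=
  Order.POrder_isJoinSemilattice.Build ring_display (BanachLattice.sort E)
    (@blat_leUx R E).

Record directed (I : Type) (le : I -> I -> Prop) : Prop := Directed {
  directed_inhabited : inhabited I ;
  directed_refl : forall i, le i i ;
  directed_trans : forall i j k, le i j -> le j k -> le i k ;
  directed_ub : forall i j, exists k, le i k /\ le j k
}.

(* A net is a function [x] on a directed set [(I, le)]; it converges when [x]
   does along the filter generated by the tails [{j | le i j}]. *)
Definition tails (I : Type) (le : I -> I -> Prop) : set_system I :=
  filter_from [set: I] (fun i => [set j | le i j]).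

Definition order_continuous_norm (R : realType) (E : banachLatticeType R) :
    Prop :=
  forall (I : Type) (le : I -> I -> Prop) (x : I -> E),
    directed le ->
    {homo x : i j / le i j >-> j <= i} ->
    infimums (range x) 0 ->
    `|x i| @[i --> tails le] --> (0 : R).

Definition KB_space (R : realType) (E : banachLatticeType R) : Prop :=
  forall x : nat -> E,
    nondecreasing_seq x ->
    (forall n, 0 <= x n) ->
    [bounded x n | n in [set: nat]] ->
    cvg (x @ \oo).

Definition KB_operator (R : realType) (E : banachLatticeType R)
    (T : {linear E -> E}) : Prop :=
  continuous T /\
  forall (I : Type) (le : I -> I -> Prop) (x : I -> E),
    directed le ->
    {homo x : i j / le i j >-> i <= j} ->
    (forall i, 0 <= x i) ->
    [bounded x i | i in [set: I]] ->
    exists y : E, `|T (x i) - T y| @[i --> tails le] --> (0 : R).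

Definition positive_operator (R : realType) (E : banachLatticeType R)
    (T : {linear E -> E}) : Prop :=
  forall x : E, 0 <= x -> 0 <= T x.

(* Continuity is not required separately: relative compactness of the image of
   the unit ball makes [T] bounded. *)
Definition compact_operator (R : realType) (E : banachLatticeType R)
    (T : {linear E -> E}) : Prop :=
  precompact (T @` [set x : E | `|x| <= 1]).

(* Main.v *)
Require Import Defs.
From HB Require Import structures.
From mathcomp Require Import all_boot all_order all_algebra.
From mathcomp Require Import all_classical all_reals.
From mathcomp Require Import topology normedtype sequences.

(** In a KB-space even increasing bounded nets converge in norm
    ([KB_space_net_cvg]), and a compact operator is continuous, so it carries
    the limit of the net to the limit of the image net.  This gives one
    direction.

    For the other, suppose that [x] is an increasing bounded sequence of positive
    elements that does not converge.  The model is [c_0] with [x n] the sum of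
    the first [n] unit vectors: the diagonal operator with entries [4^-n] is
    compact, and it maps [x n] to a sequence whose limit could only be the image
    of the constant sequence [1], which is not in [c_0].  The proof reproduces
    this picture inside [E].

    - Order continuity makes order bounded increasing sequences Cauchy
      ([order_bounded_cauchy]).  Hence [x n] cannot stay close to the multiples
      of any [x m] ([pospart_escape]), and a disjointification yields pairwise
      disjoint positive [e j], each below some member of [x], with norms bounded
      below by some [d > 0] ([disjoint_sequence]).

    - For each [j] the Hahn-Banach theorem provides a positive functional [f j]
      of norm at most one with [f j (e j) = `|e j|] that only sees the band
      generated by [e j] ([component_functional]).  The domination is by
      [component_norm], the supremum of the norms of the truncations of the
      positive part at the multiples of [e j]; so no band projections are
      needed.

    - The operator [T y = \sum_n 4^-n f_n(y) e_n] is positive, and compact since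
      the image of the unit ball lies in a continuous image of a compact cube
      ([diagonal_operator]).

    If [T (x n)] converged to some [T y], then applying [f j] would give
    [f j y = lim_n f j (x n) >= d] for all [j].  By domination, [y] would then
    have, below its positive part, pairwise disjoint truncations at multiples of
    the [e j], all of norm at least [d / 2].  Their partial sums are increasing
    and order bounded, hence Cauchy: a contradiction. *)

Set Implicit Arguments.
Unset Strict Implicit.
Unset Printing Implicit Defensive.

Import Order.TTheory GRing.Theory Num.Theory.
Import numFieldNormedType.Exports.

Local Open Scope classical_set_scope.
Local Open Scope ring_scope.

(** * Order and norm in a Banach lattice *)

Section VectorLattice.
Context {R : realType} {E : banachLatticeType R}.
Implicit Types (x y z u v e : E) (a b t : R).

Lemma bl_leD2r z x y : (x + z <= y + z) = (x <= y).
Proof.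
apply/idP/idP => [h|]; last exact: blat_leD2r.
by rewrite -[x](addrK z) -[y](addrK z); exact: blat_leD2r.
Qed.

Lemma bl_leD2l z x y : (z + x <= z + y) = (x <= y).
Proof. by rewrite ![z + _]addrC bl_leD2r. Qed.

Lemma bl_leD x y z u : x <= y -> z <= u -> x + z <= y + u.
Proof.
by move=> xy zt; apply: (@le_trans _ _ (y + z)); rewrite ?bl_leD2r ?bl_leD2l.
Qed.

Lemma bl_subr_ge0 x y : (0 <= y - x) = (x <= y).
Proof. by rewrite -(bl_leD2r x 0) add0r subrK. Qed.

Lemma bl_leBlDr x y z : (x - y <= z) = (x <= z + y).
Proof. by rewrite -(bl_leD2r y (x - y)) subrK. Qed.

Lemma bl_leBrDr x y z : (x <= y - z) = (x + z <= y).
Proof. by rewrite -(bl_leD2r z x) subrK. Qed.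

Lemma bl_leN2 x y : (- x <= - y) = (y <= x).
Proof. by rewrite -(bl_subr_ge0 (- x)) opprK addrC bl_subr_ge0. Qed.

Lemma bl_oppr_le0 x : (- x <= 0) = (0 <= x).
Proof. by rewrite -{1}oppr0 bl_leN2. Qed.

Lemma bl_addr_ge0 x y : 0 <= x -> 0 <= y -> 0 <= x + y.
Proof. by move=> x0 y0; rewrite -[0 in X in X <= _](addr0 0) bl_leD. Qed.

Lemma bl_sum_ge0 (u : nat -> E) (P : pred nat) (r : seq nat) :
  (forall n, 0 <= u n) -> 0 <= \sum_(i <- r | P i) u i.
Proof.
by move=> u0; apply: (big_ind (fun x => 0 <= x)) => //; exact: bl_addr_ge0.
Qed.

Lemma bl_scale_ge0 a x : 0 <= a -> 0 <= x -> 0 <= a *: x.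
Proof. exact: blat_scale_ge0. Qed.

Lemma bl_leZ a x y : 0 <= a -> x <= y -> a *: x <= a *: y.
Proof.
move=> a0; rewrite -(bl_subr_ge0 x) -(bl_subr_ge0 (a *: x)) -scalerBr => xy.
exact: bl_scale_ge0.
Qed.

Lemma bl_leZ2 a b x : a <= b -> 0 <= x -> a *: x <= b *: x.
Proof.
by rewrite -subr_ge0 => ab x0; rewrite -bl_subr_ge0 -scalerBl bl_scale_ge0.
Qed.

Lemma bl_leZp a x y : 0 < a -> (a *: x <= a *: y) = (x <= y).
Proof.
move=> a0; apply/idP/idP => [h|]; last exact/bl_leZ/ltW.
rewrite -[x](scalerK (lt0r_neq0 a0)) -[y](scalerK (lt0r_neq0 a0)).
by apply: bl_leZ => //; rewrite invr_ge0 ltW.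
Qed.

Lemma bl_meetZ a x y : 0 < a -> a *: (x `&` y)%O = ((a *: x) `&` (a *: y))%O.
Proof.
move=> a0; apply: le_anti; rewrite lexI !bl_leZp // leIl leIr /=.
set z := ((a *: x) `&` (a *: y))%O.
rewrite -[z](scalerKV (lt0r_neq0 a0)) bl_leZp // lexI.
by rewrite -(bl_leZp _ _ a0) -[X in _ && X](bl_leZp _ _ a0)
  !scalerKV ?lt0r_neq0 // leIl leIr.
Qed.

Lemma bl_meetD_le x y z : 0 <= x -> 0 <= y -> 0 <= z ->
  ((x + y) `&` z <= (x `&` z)%O + (y `&` z)%O)%O.
Proof.
move=> x0 y0 z0; set m := ((x + y) `&` z)%O.
have mxy : m <= x + y by exact: leIl.
have mz : m <= z by exact: leIr.
rewrite -bl_leBlDr lexI !bl_leBlDr; apply/andP; split; last first.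
  by rewrite (le_trans mz)// -{1}[z]addr0 bl_leD2l lexI y0 /=.
rewrite addrC -bl_leBlDr lexI !bl_leBlDr addrC mxy /=.
by rewrite (le_trans mz)// -{1}[z]addr0 bl_leD2l.
Qed.

Definition pospart x := (x `|` 0)%O.

Lemma pospart_ge0 x : 0 <= pospart x. Proof. exact: leUr. Qed.

Lemma le_pospart x : x <= pospart x. Proof. exact: leUl. Qed.

Lemma pospart_le x y : (pospart x <= y) = (x <= y) && (0 <= y).
Proof. exact: leUx. Qed.

Lemma pospart_mono x y : x <= y -> pospart x <= pospart y.
Proof.
by move=> xy; rewrite pospart_le pospart_ge0 (le_trans xy)// le_pospart.
Qed.

Lemma ge0_pospart x : 0 <= x -> pospart x = x.
Proof.
by move=> x0; apply: le_anti; rewrite pospart_le lexx x0 le_pospart.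
Qed.

Lemma pospartD_le x y : pospart (x + y) <= pospart x + pospart y.
Proof.
by rewrite pospart_le bl_leD ?le_pospart //= bl_addr_ge0 ?pospart_ge0.
Qed.

Lemma pospartZ a x : 0 < a -> pospart (a *: x) = a *: pospart x.
Proof.
move=> a0; apply: le_anti; rewrite pospart_le bl_leZp // le_pospart /=.
rewrite bl_scale_ge0 ?(ltW a0) ?pospart_ge0 //=.
rewrite -[pospart (a *: x)](scalerKV (lt0r_neq0 a0)) bl_leZp // pospart_le.
rewrite -(bl_leZp _ _ a0) -[X in _ && X](bl_leZp _ _ a0).
by rewrite !scalerKV ?lt0r_neq0 // scaler0 le_pospart pospart_ge0.
Qed.

Lemma pospart_decomp x : pospart x - pospart (- x) = x.
Proof.
apply/eqP; rewrite subr_eq; apply/eqP/le_anti/andP; split.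
  rewrite pospart_le -{1}[x]addr0 bl_leD2l pospart_ge0 /=.
  by rewrite addrC -bl_leBlDr sub0r le_pospart.
rewrite addrC -bl_leBrDr pospart_le !bl_leBrDr addNr add0r.
by rewrite pospart_ge0 le_pospart.
Qed.

Lemma meetE x y : (x `&` y)%O = x - pospart (x - y).
Proof.
apply: le_anti; apply/andP; split; last first.
  rewrite lexI !bl_leBlDr -[X in X <= _ + _]addr0 bl_leD2l pospart_ge0 /=.
  by rewrite addrC -bl_leBlDr le_pospart.
rewrite bl_leBrDr addrC -bl_leBrDr pospart_le bl_leD2l bl_leN2 bl_subr_ge0.
by rewrite leIl leIr.
Qed.

Lemma disjoint_le x y u v : 0 <= u -> 0 <= v -> u <= x -> v <= y ->
  (x `&` y = 0 -> u `&` v = 0)%O.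
Proof.
move=> u0 v0 ux vy xy; apply: le_anti; rewrite lexI u0 v0 !andbT -xy.
by rewrite lexI (le_trans _ ux) ?leIl // (le_trans _ vy) ?leIr.
Qed.

Lemma pospart_disjoint x : (pospart x `&` pospart (- x) = 0)%O.
Proof.
rewrite meetE -[X in _ - pospart X](_ : x = _) ?subrr //.
by rewrite pospart_decomp.
Qed.

Lemma disjointZ t x y : 0 <= t -> 0 <= x -> 0 <= y ->
  (x `&` y = 0 -> x `&` (t *: y) = 0)%O.
Proof.
move=> t0 x0 y0 xy.
have t1 : 0 < t + 1 by rewrite ltr_wpDl.
apply: (@disjoint_le ((t + 1) *: x) ((t + 1) *: y)) => //.
- exact: bl_scale_ge0.
- by rewrite -[X in X <= _]scale1r bl_leZ2 // lerDr.
- by rewrite bl_leZ2 // lerDl.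
- by rewrite -bl_meetZ // xy scaler0.
Qed.

(** [x + y - u] lies below both [x] and [y], hence below their meet [0]. *)
Lemma disjointD_le x y u : (x `&` y = 0)%O -> x <= u -> y <= u -> x + y <= u.
Proof.
move=> xy xu yu; rewrite -[u]add0r -xy -bl_leBlDr lexI !bl_leBlDr.
by rewrite bl_leD2l yu addrC bl_leD2l.
Qed.

(** Pairwise disjoint elements below [u] add up below [u], because their sum is
    their supremum. *)
Lemma disjoint_sum_le (z : nat -> E) u :
  (forall j, 0 <= z j) -> (forall j, z j <= u) ->
  (forall j k, (j < k)%N -> (z j `&` z k = 0)%O) ->
  forall n, \sum_(0 <= j < n) z j <= u.
Proof.
move=> z0 zu zz; have u0 : 0 <= u by exact: le_trans (z0 0%N) (zu 0%N).
have S0 n : 0 <= \sum_(0 <= j < n) z j by exact: bl_sum_ge0.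
have disj n k : (n <= k)%N -> ((\sum_(0 <= j < n) z j) `&` z k = 0)%O.
  elim: n => [_|n IH nk].
    by rewrite big_geq //; apply: le_anti; rewrite leIl lexI lexx z0.
  rewrite big_nat_recr //=; apply: le_anti; rewrite lexI z0 andbT.
  rewrite bl_addr_ge0 // andbT (le_trans (bl_meetD_le _ _ _)) //.
  by rewrite IH ?(ltnW nk) // zz // addr0.
elim=> [|n IH]; first by rewrite big_geq.
by rewrite big_nat_recr //=; apply: disjointD_le => //; exact: disj.
Qed.

Lemma modulus_ge0 x : 0 <= (x `|` (- x))%O.
Proof.
have h : 0 <= (2 : R) *: (x `|` (- x))%O.
  by rewrite scaler_nat mulr2n -(subrr x) bl_leD ?leUl ?leUr.
by rewrite -(bl_leZp _ _ (ltr0n R 2)) scaler0.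
Qed.

Lemma norm_mono x y : 0 <= x -> x <= y -> `|x| <= `|y|.
Proof.
move=> x0 xy; apply: blat_le_norm.
have y0 := le_trans x0 xy.
change (x `|` - x <= y `|` - y)%O.
by rewrite leUx !(le_trans _ (leUl _ _)) // (le_trans _ y0) // bl_oppr_le0.
Qed.

Lemma norm_pospart x : `|pospart x| <= `|x|.
Proof.
apply: blat_le_norm; change (pospart x `|` - pospart x <= x `|` - x)%O.
have px : pospart x <= (x `|` - x)%O by rewrite pospart_le leUl modulus_ge0.
by rewrite leUx px (le_trans _ (modulus_ge0 _)) // bl_oppr_le0 pospart_ge0.
Qed.

(** The positive part of [y - x] is dominated by elements of arbitrarily small
    norm.  This one estimate yields both the closedness of the positive cone and
    the Archimedean property. *)
Lemma le_of_small_excess x y :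
  (forall eps : R, 0 < eps -> exists2 u, y <= x + u & `|u| <= eps) -> y <= x.
Proof.
move=> h; rewrite -bl_subr_ge0 -bl_oppr_le0 opprB.
rewrite -[y - x]pospart_decomp.
suff -> : pospart (y - x) = 0 by rewrite sub0r bl_oppr_le0 pospart_ge0.
apply/eqP; rewrite -normr_le0; apply/ler_addgt0Pl => e e0; rewrite addr0.
have [u yu ue] := h e e0; apply: le_trans ue; apply: le_trans (norm_pospart u).
by apply: norm_mono; rewrite ?pospart_ge0 // pospart_mono // bl_leBlDr addrC.
Qed.

Lemma cvg_ge0 (u : nat -> E) (l : E) :
  u @ \oo --> l -> (\forall n \near \oo, 0 <= u n) -> 0 <= l.
Proof.
move=> ul u0; apply: le_of_small_excess => e e0.
have /cvgrPdist_le/(_ _ e0) h := ul.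
have [n [un0 ule]] := filter_ex (filterI u0 h).
by exists (u n - l); [rewrite addrC subrK|rewrite distrC].
Qed.

Lemma archimedean x y : (forall n : nat, n%:R *: x <= y) -> x <= 0.
Proof.
move=> h; apply: le_of_small_excess => e e0.
pose n := (Num.truncn (`|y| / e)).+1.
have n0 : 0 < n%:R :> R by rewrite ltr0n.
exists (n%:R^-1 *: y).
  by rewrite add0r -(bl_leZp _ _ n0) scalerKV ?lt0r_neq0.
rewrite normrZ ger0_norm ?invr_ge0 ?ler0n // ler_pdivrMl // -ler_pdivrMr //.
by rewrite ltW // truncnS_gt.
Qed.

End VectorLattice.

(** * Increasing nets *)

Lemma tails_properfilter (I : Type) (le : I -> I -> Prop) :
  directed le -> ProperFilter (tails le).
Proof.
move=> [[i0] le_refl le_trans le_ub]; apply: filter_from_proper.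
- apply: filter_from_filter; first by exists i0.
  move=> i j _ _; have [k [ik jk]] := le_ub i j.
  by exists k => // l kl; split; [exact: le_trans kl|exact: le_trans kl].
- by move=> i _; exists i; exact: le_refl.
Qed.

Lemma leq_directed : directed (fun m n : nat => (m <= n)%N).
Proof.
split; [by constructor; exact: 0%N|by []|by move=> i j k; exact: leq_trans|].
by move=> i j; exists (maxn i j); rewrite leq_maxl leq_maxr.
Qed.

(** Stated for nets, so that it serves both for nets in a KB-space and, with the
    natural numbers as index set, for sequences. *)
Lemma net_not_cvg_gap (R : realType) (V : completeNormedModType R) (I : Type)
    (le : I -> I -> Prop) (x : I -> V) :
  directed le -> ~ cvg (x @ tails le) ->
  exists2 e : R, 0 < e & forall i, exists2 j, le i j & e <= `|x j - x i|.
Proof.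
move=> dle ncx; have FF := tails_properfilter dle.
apply: contrapT => h; apply: ncx; apply/cauchy_cvgP/cauchy_ballP => e e0.
suff [i hi] : exists i, forall j, le i j -> `|x j - x i| < e / 2.
  exists (x @` [set j | le i j], x @` [set j | le i j]) => /=.
    by split; exists i => //= j ij; exists j.
  move=> [_ _] /= [[j ij <-] [k ik <-]]; rewrite -ball_normE /=.
  rewrite -(subrKA (x i)) (le_lt_trans (ler_normD _ _)) // [ltRHS]splitr.
  by rewrite ltrD ?hi // distrC hi.
apply: contrapT => /forallNP hn; apply: h.
exists (e / 2); first by rewrite divr_gt0.
move=> i; apply: contrapT => hj; apply: (hn i) => j ij; rewrite ltNge.
by apply/negP => ?; apply: hj; exists j.
Qed.

Section OrderContinuous.
Context {R : realType} {E : banachLatticeType R}.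

(** The differences [b - x n], with [b] an upper bound of the sequence, form a
    net decreasing to [0]: a lower bound [c] can be subtracted from any upper
    bound again and again, so all its multiples stay below [u - x 0]. *)
Lemma order_bounded_cauchy (hE : order_continuous_norm E) (x : nat -> E)
    (u : E) :
  nondecreasing_seq x -> (forall n, x n <= u) ->
  forall e : R, 0 < e -> exists N, forall n, (N <= n)%N -> `|x n - x N| <= e.
Proof.
move=> xi xu e e0.
pose ub b := forall n, x n <= b.
pose I := ({b : E | ub b} * nat)%type.
pose le (i j : I) := (sval j.1 <= sval i.1) /\ (i.2 <= j.2)%N.
pose d (i : I) := sval i.1 - x i.2.
have dle : directed le.
  split.
  - by constructor; exact: (exist _ u xu, 0%N).
  - by move=> i; split.
  - move=> i j k [ij1 ij2] [jk1 jk2]; split; first exact: le_trans ij1.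
    exact: leq_trans jk2.
  - move=> [[b ubb] n] [[c ubc] m].
    have ubbc : ub (b `&` c)%O by move=> k; rewrite lexI ubb ubc.
    exists (exist _ _ ubbc, maxn n m).
    by split; split; rewrite /= ?leIl ?leIr ?leq_maxl ?leq_maxr.
have dh : {homo d : i j / le i j >-> j <= i}.
  by move=> i j [ij1 ij2]; rewrite /d bl_leD // bl_leN2 xi.
have dinf : infimums (range d) 0.
  split; first by move=> _ [[[b ubb] n] _ <-]; rewrite /d /= bl_subr_ge0.
  move=> c lbc.
  have step b : ub b -> ub (b - c).
    move=> ubb n; rewrite bl_leBrDr addrC -bl_leBrDr.
    by apply: lbc; exists (exist _ b ubb, n).
  have iter k : ub (u - k%:R *: c).
    elim: k => [|k IH]; first by rewrite scale0r subr0.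
    by rewrite -addn1 natrD scalerDl scale1r opprD addrA; exact: step.
  apply: (@archimedean _ _ _ (u - x 0%N)) => k.
  by rewrite bl_leBrDr addrC -bl_leBrDr; exact: iter.
have FF := tails_properfilter dle.
have /cvgr0Pnorm_le/(_ _ e0) [[[b ubb] N] _ hN] := hE I le d dle dh dinf.
exists N => n Nn.
have := hN (exist _ b ubb, N) (conj (lexx _) (leqnn _)).
rewrite /= normr_id; apply: le_trans; apply: norm_mono.
  by rewrite bl_subr_ge0 xi.
by rewrite bl_leD2r.
Qed.

(** If the net diverged, gaps of a fixed size would occur beyond every index;
    following them gives an increasing bounded sequence that diverges. *)
Lemma KB_space_net_cvg (I : Type) (le : I -> I -> Prop) (x : I -> E) :
  KB_space E -> directed le -> {homo x : i j / le i j >-> i <= j} ->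
  (forall i, 0 <= x i) -> [bounded x i | i in [set: I]] ->
  cvg (x @ tails le).
Proof.
move=> KB dle xh x0 xb; apply: contrapT => /(net_not_cvg_gap dle)[e e0 gap].
have next i : exists j, le i j /\ e <= `|x j - x i|.
  by have [j] := gap i; exists j.
have [f hf] := choice next.
have [i0] := directed_inhabited dle.
pose s n := iter n f i0.
have sle m n : (m <= n)%N -> le (s m) (s n).
  elim: n => [|n IH]; first by rewrite leqn0 => /eqP->; exact: directed_refl.
  rewrite leq_eqVlt => /predU1P[->|mn]; first exact: directed_refl.
  by apply: (directed_trans dle) (IH mn) _; exact: (hf _).1.
have : cvg ((x \o s) @ \oo).
  apply: KB.
  - by move=> m n mn; apply: xh; exact: sle.
  - by move=> n; exact: x0.
  - by move: xb; rewrite /bounded_near; apply: filterS => M hM n _; exact: hM.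
move=> /cvg_ex[l /cvgrPdist_lt/(_ (e / 2))[|N _ hN]];
  first by rewrite divr_gt0.
have := (hf (s N)).2; rewrite leNgt => /negP; apply.
rewrite -(subrKA l) (le_lt_trans (ler_normD _ _)) //.
rewrite [ltRHS]splitr ltrD //; last exact: (hN N (leqnn N)).
by rewrite distrC; exact: (hN N.+1 (leqnSn N)).
Qed.

(** A relatively compact image of the unit ball is bounded. *)
Lemma compact_operator_continuous (T : {linear E -> E}) :
  compact_operator T -> continuous T.
Proof.
rewrite /compact_operator precompactE => /compact_bounded bT.
apply/linear_bounded_continuous.
have /pinfty_ex_gt0[M M0 hM] := bT.
apply/ex_bound; exists M; apply/nbhs_norm0P; exists 1 => //= x x1.
by apply: hM; apply: subset_closure; exists x => //=; exact: ltW.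
Qed.

Lemma KB_space_operator (T : {linear E -> E}) :
  KB_space E -> compact_operator T -> KB_operator T.
Proof.
move=> KB /compact_operator_continuous cT; split=> // I le x dle xh x0 xb.
have FF := tails_properfilter dle.
have /cvg_ex[y xy] := KB_space_net_cvg KB dle xh x0 xb.
exists y; apply/cvgr0Pnorm_lt => e e0.
have /cvgrPdist_lt/(_ e e0) : T (x i) @[i --> tails le] --> T y.
  by apply: continuous_cvg => //; exact: cT.
by apply: filterS => i; rewrite normr_id distrC.
Qed.

End OrderContinuous.

(** * Extraction of a disjoint sequence *)

Section GeometricSeries.
Context {R : realType} {V : completeNormedModType R}.
Variables (u : nat -> V) (M : R).
Hypothesis uM : forall n, `|u n| <= geometric M 2^-1 n.

Let half_lt1 : `|2^-1 : R| < 1.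
Proof. by rewrite ger0_norm ?invr_ge0 // invf_lt1 // ltr1n. Qed.

Let geo_cvg : series (geometric M 2^-1) @ \oo --> M * (1 - 2^-1 : R)^-1.
Proof. exact: cvg_geometric_series. Qed.

Lemma geometric_normed_cvg : cvgn [normed series u].
Proof.
apply: (@series_le_cvg _ _ (geometric M 2^-1)) => [n|n|n|] /=.
- exact: normr_ge0.
- exact: le_trans (normr_ge0 _) (uM n).
- exact: uM.
- by apply/cvg_ex; eexists; exact: geo_cvg.
Qed.

Lemma geometric_cvg : cvgn (series u).
Proof. exact/normed_cvg/geometric_normed_cvg. Qed.

Lemma geometric_norm_lim : `|limn (series u)| <= 2 * M.
Proof.
apply: le_trans (lim_series_norm geometric_normed_cvg) _.
have -> : 2 * M = limn (series (geometric M 2^-1)).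
  rewrite (cvg_lim _ geo_cvg) // mulrC; congr (_ * _).
  by rewrite [X in X - _](splitr 1) div1r addrK invrK.
apply: lim_series_le => //; first exact: geometric_normed_cvg.
by apply/cvg_ex; eexists; exact: geo_cvg.
Qed.

End GeometricSeries.

Section DisjointSequence.
Context {R : realType} {E : banachLatticeType R}.

Lemma series_ge0_lim (u : nat -> E) :
  (forall n, 0 <= u n) -> cvgn (series u) -> 0 <= limn (series u).
Proof.
by move=> u0 cu; apply: cvg_ge0 cu _; apply: nearW => n; exact: bl_sum_ge0.
Qed.

Lemma series_ge0_le_lim (u : nat -> E) k :
  (forall n, 0 <= u n) -> cvgn (series u) -> u k <= limn (series u).
Proof.
move=> u0 cu; rewrite -bl_subr_ge0.
apply: (@cvg_ge0 _ _ (fun n => series u n - u k)).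
  by apply: cvgB => //; exact: cvg_cst.
exists k.+1 => // n /= kn; rewrite bl_subr_ge0 /series /=.
rewrite (bigD1_seq k) ?mem_index_iota ?iota_uniq //=.
by rewrite -{1}[u k]addr0 bl_leD2l bl_sum_ge0.
Qed.

(** Split [x n] into [y n], its meet with [C *: x m], and the positive part of
    [x n - C *: x m].  The [y n] are increasing and order bounded, hence Cauchy;
    if the second summand were small for all [n >= m], the gaps of [x] would
    close. *)
Lemma pospart_escape (hE : order_continuous_norm E) (x : nat -> E) :
  nondecreasing_seq x -> (forall n, 0 <= x n) -> ~ cvg (x @ \oo) ->
  exists2 d : R, 0 < d & forall m (C : R), 0 <= C ->
    exists2 n, (m <= n)%N & d <= `|pospart (x n - C *: x m)|.
Proof.
move=> xi x0 /(net_not_cvg_gap leq_directed)[e e0 gap].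
(* A gap [e] would be at most one oscillation of [y] plus two remainders, so any
   bound of at most a third of [e] will do; a quarter is convenient. *)
have d0 : 0 < e / 2 / 2 by rewrite !divr_gt0.
exists (e / 2 / 2) => // m C C0; apply: contrapT => h.
have {}h n : (m <= n)%N -> `|pospart (x n - C *: x m)| < e / 2 / 2.
  by move=> mn; rewrite ltNge; apply/negP => ?; apply: h; exists n.
pose y n : E := (x n `&` (C *: x m))%O.
have yi : nondecreasing_seq y.
  by move=> i j ij; rewrite lexI leIr (le_trans (leIl _ _)) // xi.
have [N hN] := order_bounded_cauchy hE yi (fun n => leIr _ _) d0.
have [n kn] := gap (maxn m N); have /andP[mn Nn] : (m <= n)%N && (N <= n)%N.
  by rewrite -geq_max.
set k := maxn m N in kn *; have mk : (m <= k)%N by rewrite leq_maxl.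
have Nk : (N <= k)%N by rewrite leq_maxr.
have yk : `|y n - y k| <= e / 2 / 2.
  apply: le_trans (hN n Nn); apply: norm_mono.
    by rewrite bl_subr_ge0 yi.
  by rewrite bl_leD2l bl_leN2 yi.
have yE j : x j = y j + pospart (x j - C *: x m) by rewrite /y meetE subrK.
rewrite leNgt => /negP; apply; rewrite (yE n) (yE k) opprD addrACA.
rewrite (le_lt_trans (ler_normD _ _)) // [ltRHS]splitr ler_ltD //.
  by rewrite (le_trans yk) // ler_pdivrMr // ler_peMr ?ler1n // ltW // divr_gt0.
by rewrite (le_lt_trans (ler_normB _ _)) // [ltRHS]splitr ltrD // h.
Qed.

(** Choose a subsequence, written [y k] here, along which the elements
    [v k], the positive parts of [y k.+1 - C k *: y k], have norm at least [d],
    with [C k] growing geometrically.  For [j < k] the element [v j] is below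
    [y k], so [v j] exceeds [y k.+1] divided by [C k] by at most a
    multiple of the positive part of [C k *: y k - y k.+1], which is disjoint
    from [v k].  Subtracting from all the [v j] one small common majorant of
    the elements [y k.+1] divided by [C k] therefore makes them disjoint. *)
Lemma disjoint_sequence (hE : order_continuous_norm E) (x : nat -> E) (M : R) :
  nondecreasing_seq x -> (forall n, 0 <= x n) -> (forall n, `|x n| <= M) ->
  ~ cvg (x @ \oo) ->
  exists (d : R) (e : nat -> E) (m : nat -> nat), [/\ 0 < d,
    forall j, 0 <= e j <= x (m j),
    forall j k, (j < k)%N -> (e j `&` e k = 0)%O &
    forall j, d <= `|e j|].
Proof.
move=> xi x0 xM ncx; have [d d0 esc] := pospart_escape hE xi x0 ncx.
have M0 : 0 <= M by exact: le_trans (xM 0%N).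
(* [K] makes the majorant [K^-1 *: w] below, where [`|w| <= 2 * M], have norm at
   most [d / 2]; the summand [1] ensures [1 <= C k]. *)
pose K := 1 + 2 * M / (d / 2).
have d2 : 0 < d / 2 by rewrite divr_gt0.
have K1 : 1 <= K by rewrite lerDl divr_ge0 ?(ltW d2) // mulr_ge0.
have K0 : 0 < K by exact: lt_le_trans K1.
pose C k : R := K * 2 ^+ k.
have C1 k : 1 <= C k by rewrite mulr_ege1 // exprn_ege1 // ler1n.
have C0 k : 0 < C k by exact: lt_le_trans (C1 k).
have next (mk : nat * nat) : exists n, (mk.1 <= n)%N /\
    d <= `|pospart (x n - C mk.2 *: x mk.1)|.
  by have [n] := esc mk.1 _ (ltW (C0 mk.2)); exists n.
have [f hf] := choice next.
pose m := fix m k := if k is k'.+1 then f (m k', k') else 0%N.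
have mS k : (m k <= m k.+1)%N := (hf (m k, k)).1.
have mi : {homo m : i j / (i <= j)%N} by exact: homo_leq leqnn leq_trans mS.
pose v k := pospart (x (m k.+1) - C k *: x (m k)).
have dv k : d <= `|v k| := (hf (m k, k)).2.
have vx k : v k <= x (m k.+1).
  rewrite pospart_le x0 andbT -[X in _ <= X]subr0 bl_leD2l bl_leN2.
  by rewrite bl_scale_ge0 // ltW.
pose u k := (2^-1 ^+ k : R) *: x (m k.+1).
have h0 k : 0 < (2^-1 ^+ k : R) by rewrite exprn_gt0 // invr_gt0.
have u0 k : 0 <= u k by rewrite bl_scale_ge0 // ltW.
have uM k : `|u k| <= geometric M 2^-1 k.
  by rewrite normrZ gtr0_norm // /= mulrC ler_wpM2r // ltW.
(* The series dominates each [2^-k *: x (m k.+1)], hence [K^-1 *: w] dominates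
   each [x (m k.+1)] divided by [C k = K * 2 ^+ k]. *)
pose w := limn (series u).
have w0 : 0 <= w by apply: series_ge0_lim => //; exact: geometric_cvg uM.
have wM : `|w| <= 2 * M by exact: geometric_norm_lim.
have uw k : u k <= w by apply: series_ge0_le_lim => //; exact: geometric_cvg uM.
have xw k : x (m k.+1) <= C k *: (K^-1 *: w).
  rewrite scalerA /C mulrAC divff ?lt0r_neq0 // mul1r.
  have := uw k; rewrite -(bl_leZp _ _ (exprn_gt0 k (ltr0n R 2))).
  by rewrite /u scalerA -exprMn divff ?pnatr_eq0 // expr1n scale1r.
pose e k := pospart (v k - K^-1 *: w).
have s0 : 0 <= K^-1 *: w by rewrite bl_scale_ge0 // invr_ge0 ltW.
have ev k : e k <= v k.
  rewrite pospart_le pospart_ge0 andbT -[X in _ <= X]subr0.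
  by rewrite bl_leD2l bl_leN2.
exists (d / 2), e, (fun k => m k.+1); split => //.
- by move=> k; rewrite pospart_ge0 (le_trans (ev k)) ?vx.
- move=> j k jk; pose a := x (m k.+1) - C k *: x (m k).
  apply: (@disjoint_le _ _ (pospart (- a)) (pospart a)).
  + exact: pospart_ge0.
  + exact: pospart_ge0.
  + rewrite pospart_le pospart_ge0 andbT /a opprB.
    have ej : v j - K^-1 *: w <= x (m k) - (C k)^-1 *: x (m k.+1).
      rewrite bl_leD //; first by rewrite (le_trans (vx j)) // xi // mi.
      by rewrite bl_leN2 -(bl_leZp _ _ (C0 k)) scalerKV ?lt0r_neq0.
    rewrite (le_trans ej) // (le_trans (le_pospart _)) //.
    have -> : C k *: x (m k) - x (m k.+1) =
      C k *: (x (m k) - (C k)^-1 *: x (m k.+1)).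
      by rewrite scalerBr scalerKV ?lt0r_neq0.
    by rewrite pospartZ // -[X in X <= _]scale1r bl_leZ2 // pospart_ge0.
  + exact: ev.
  + by rewrite meetC pospart_disjoint.
- move=> k; rewrite -(lerD2r (d / 2)) -splitr (le_trans (dv k)) //.
  have vle : v k <= e k + K^-1 *: w by rewrite -bl_leBlDr le_pospart.
  apply: le_trans (norm_mono (pospart_ge0 _) vle) _.
  rewrite (le_trans (ler_normD _ _)) // lerD2l normrZ gtr0_norm ?invr_gt0 //.
  rewrite ler_pdivrMl // (le_trans wM) //.
  by rewrite /K [leRHS]mulrDl mul1r divfK ?lt0r_neq0 // lerDr ltW.
Qed.

End DisjointSequence.

(** * The Hahn-Banach theorem for sublinear functionals *)

Section ScalarFunction.
Context {R : realType} {V : lmodType R} {g : V -> R}.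
Hypothesis gl : scalar g.

Lemma scalar_fun0 : g 0 = 0.
Proof.
by have := gl 1 0 0; rewrite scaler0 addr0 mul1r -{1}[g 0]addr0 => /addrI <-.
Qed.

Lemma scalar_funZ (a : R) x : g (a *: x) = a * g x.
Proof. by rewrite -[a *: x]addr0 gl scalar_fun0 addr0. Qed.

Lemma scalar_funN x : g (- x) = - g x.
Proof. by rewrite -scaleN1r scalar_funZ mulN1r. Qed.

Lemma scalar_funD x y : g (x + y) = g x + g y.
Proof. by rewrite -[x in LHS]scale1r gl mul1r. Qed.

Lemma scalar_funB x y : g (x - y) = g x - g y.
Proof. by rewrite scalar_funD scalar_funN. Qed.

End ScalarFunction.

Section HahnBanach.
Context {R : realType} {V : lmodType R}.
Implicit Types (p q : V -> R) (x y e : V).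

Record sublinear p : Prop := Sublinear {
  sublinearD : forall x y, p (x + y) <= p x + p y ;
  sublinearZ_le : forall (a : R) x, 0 <= a -> p (a *: x) <= a * p x }.

Lemma sublinear0 p : sublinear p -> p 0 = 0.
Proof.
move=> [pD pZ]; apply: le_anti; apply/andP; split.
  by have := pZ 0 0 (lexx _); rewrite scale0r mul0r.
by have := pD 0 0; rewrite addr0 -{1}[p 0]addr0 lerD2l.
Qed.

Lemma sublinearZ p (a : R) x : sublinear p -> 0 <= a -> p (a *: x) = a * p x.
Proof.
move=> sp; rewrite le_eqVlt => /predU1P[<-|a0].
  by rewrite scale0r mul0r sublinear0.
apply: le_anti; rewrite sublinearZ_le ?(ltW a0) //=.
have ai : 0 <= a^-1 by rewrite invr_ge0 ltW.
have := sublinearZ_le sp (a *: x) ai.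
by rewrite scalerK ?lt0r_neq0 // ler_pdivlMl.
Qed.

Lemma sublinear_geN p x : sublinear p -> - p (- x) <= p x.
Proof.
move=> sp; rewrite lerNl -subr_ge0 opprK -[leLHS](sublinear0 sp) -(subrr x).
by rewrite addrC (le_trans (sublinearD sp _ _)) // addrC.
Qed.

(** The largest sublinear functional below [q] that is at most [- q e] at
    [- e].  It serves twice: a minimal [q] must coincide with all its tilts, which
    forces linearity, and tilting the dominating functional once at [e] makes the
    linear minorant attain its value at [e]. *)
Definition tilt q e x :=
  inf [set q (x + t *: e) - t * q e | t in [set t | 0 <= t]].

(** The infimum is finite, because [q (t *: e) <= q (x + t *: e) + q (- x)]. *)
Lemma tilt_lb q e x : sublinear q ->
  lbound [set q (x + t *: e) - t * q e | t in [set t | 0 <= t]] (- q (- x)).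
Proof.
move=> sq _ [t /= t0 <-]; rewrite -(sublinearZ _ sq t0) lerBrDr addrC lerBlDr.
rewrite -{1}[t *: e](addrK x) (le_trans (sublinearD sq _ _)) //.
by rewrite lerD2r // addrC.
Qed.

Lemma tilt_le q e x t : sublinear q -> 0 <= t ->
  tilt q e x <= q (x + t *: e) - t * q e.
Proof.
move=> sq t0; apply: ge_inf; last by exists t.
by exists (- q (- x)); exact: tilt_lb.
Qed.

Lemma tilt_ge q e x b :
  (forall t, 0 <= t -> b <= q (x + t *: e) - t * q e) -> b <= tilt q e x.
Proof.
move=> h; apply: lb_le_inf; first by exists (q (x + 0 *: e) - 0 * q e), 0 => /=.
by move=> _ [t t0 <-]; exact: h.
Qed.

Lemma tilt_sublinear q e : sublinear q -> sublinear (tilt q e).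
Proof.
move=> sq; split=> [x y|a x].
  rewrite -lerBlDr; apply: tilt_ge => s s0; rewrite lerBlDr -lerBlDl.
  apply: tilt_ge => t t0; rewrite lerBlDl.
  apply: le_trans (tilt_le _ _ sq (addr_ge0 s0 t0)) _.
  rewrite scalerDl addrACA mulrDl opprD [leRHS]addrACA lerD2r.
  exact: sublinearD.
rewrite le_eqVlt => /predU1P[<-|a0].
  rewrite scale0r mul0r (le_trans (tilt_le _ _ sq (lexx _))) //.
  by rewrite scale0r addr0 mul0r subr0 sublinear0.
rewrite -ler_pdivrMl //; apply: tilt_ge => t t0; rewrite ler_pdivrMl //.
apply: le_trans (tilt_le _ _ sq (mulr_ge0 (ltW a0) t0)) _.
by rewrite -scalerA -scalerDr (sublinearZ _ sq (ltW a0)) -mulrA mulrBr.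
Qed.

Lemma tilt_le_self q e x : sublinear q -> tilt q e x <= q x.
Proof.
move=> sq; apply: le_trans (tilt_le _ _ sq (lexx _)) _.
by rewrite scale0r addr0 mul0r subr0.
Qed.

Lemma tiltN q e : sublinear q -> tilt q e (- e) <= - q e.
Proof.
move=> sq; apply: le_trans (tilt_le _ _ sq ler01) _.
by rewrite scale1r addNr mul1r sublinear0 // sub0r.
Qed.

(** Subadditivity survives in the infimum of a chain, as two members can be
    compared at the two arguments through the smaller one. *)
Lemma inf_chain_sublinear p (A : set (V -> R)) q0 : A q0 ->
  (forall q, A q -> sublinear q /\ forall x, q x <= p x) ->
  (forall q r, A q -> A r ->
    (forall x, q x <= r x) \/ (forall x, r x <= q x)) ->
  let m x := inf [set q x | q in A] in
  sublinear m /\ forall q, A q -> forall x, m x <= q x.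
Proof.
move=> Aq0 Ap tot m.
have mle q x : A q -> m x <= q x.
  move=> Aq; apply: ge_inf; last by exists q.
  exists (- p (- x)) => _ [r Ar <-]; have [sr rp] := Ap r Ar.
  by rewrite (le_trans _ (sublinear_geN x sr)) // lerN2.
have mge x b : (forall q, A q -> b <= q x) -> b <= m x.
  move=> h; apply: lb_le_inf; first by exists (q0 x); exists q0.
  by move=> _ [q Aq <-]; exact: h.
split; last by move=> q Aq x; exact: mle.
split=> [x y|a x].
  rewrite -lerBlDr; apply/mge => q Aq; rewrite lerBlDr -lerBlDl.
  apply/mge => r Ar; rewrite lerBlDl.
  have [sq _] := Ap q Aq; have [sr _] := Ap r Ar.
  case: (tot q r Aq Ar) => qr.
    apply: le_trans (mle q _ Aq) _; apply: le_trans (sublinearD sq _ _) _.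
    by rewrite lerD2l.
  apply: le_trans (mle r _ Ar) _; apply: le_trans (sublinearD sr _ _) _.
  by rewrite lerD2r.
rewrite le_eqVlt => /predU1P[<-|a0].
  have [sq _] := Ap q0 Aq0.
  by rewrite scale0r mul0r (le_trans (mle q0 _ Aq0)) // sublinear0.
rewrite -ler_pdivrMl //; apply/mge => q Aq; rewrite ler_pdivrMl //.
have [sq _] := Ap q Aq.
by rewrite -(sublinearZ _ sq (ltW a0)) mle.
Qed.

Lemma minimal_sublinear p : sublinear p -> exists q, [/\ sublinear q,
  forall x, q x <= p x &
  forall r, sublinear r -> (forall x, r x <= q x) -> r = q].
Proof.
move=> sp; pose T := {q : V -> R | sublinear q /\ forall x, q x <= p x}.
pose P : T := exist _ p (conj sp (fun x => lexx _)).
pose le (q r : T) := `[< forall x, sval r x <= sval q x >].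
have [||||q qmax] := @Zorn T le.
- by move=> q; apply/asboolP.
- move=> r s t /asboolP rs /asboolP st; apply/asboolP => x.
  exact: le_trans (rs x).
- move=> [q hq] [r hr] /asboolP qr /asboolP rq; apply/eq_exist/funext => x.
  by apply: le_anti; rewrite qr rq.
- move=> A tot.
  have [[q0 Aq0]|A0] := pselect (exists t : T, A t); last first.
    by exists P => s As; case: A0; exists s.
  pose B := [set sval t | t in A].
  have [|||sm mB] := @inf_chain_sublinear p B (sval q0).
  + by exists q0.
  + by move=> _ [q _ <-]; exact: (svalP q).
  + move=> _ _ [q Aq <-] [r Ar <-].
    by case: (tot q r Aq Ar) => /asboolP; [right|left].
  have mp x : inf [set q x | q in B] <= p x.
    apply: (le_trans (mB (sval q0) _ x)); first by exists q0.
    exact: (svalP q0).2.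
  have sT : sublinear (fun x => inf [set q x | q in B]) /\
    forall x, inf [set q x | q in B] <= p x by [].
  exists (exist _ _ sT : T) => s As; apply/asboolP => x /=.
  by apply: mB; exists s.
exists (sval q); case: (svalP q) => sq qp; split=> // r sr rq.
have rp x : r x <= p x by exact: le_trans (rq x) (qp x).
by rewrite -(qmax (exist _ r (conj sr rp))) //; apply/asboolP.
Qed.

(** Since [q] coincides with its tilt at [x], it satisfies [q (- x) <= - q x]. A
    sublinear functional that is odd is linear. *)
Lemma minimal_sublinear_scalar q : sublinear q ->
  (forall r, sublinear r -> (forall x, r x <= q x) -> r = q) -> scalar q.
Proof.
move=> sq qmin.
have qN x : q (- x) = - q x.
  apply: le_anti; rewrite -{1}(qmin (tilt q x)).
  - by rewrite tiltN //= lerNl sublinear_geN.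
  - exact: tilt_sublinear.
  - by move=> y; exact: tilt_le_self.
have qD x y : q (x + y) = q x + q y.
  apply: le_anti; rewrite sublinearD //= -[leRHS]opprK -qN lerNr !opprD -!qN.
  exact: sublinearD.
move=> a x y; rewrite qD; congr (_ + _).
have [a0|a0] := leP 0 a; first exact: sublinearZ.
rewrite -[a]opprK scaleNr qN mulNr; congr (- _).
by rewrite sublinearZ // oppr_ge0 ltW.
Qed.

(** The minimal sublinear functional is taken below the tilt of [p] at [e], where
    it is at most [- p e] at [- e]. *)
Lemma hahn_banach p e : sublinear p ->
  exists f : V -> R, [/\ scalar f, forall x, f x <= p x & f e = p e].
Proof.
move=> sp; have [q [sq qp qmin]] := minimal_sublinear (tilt_sublinear e sp).
have fq := minimal_sublinear_scalar sq qmin.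
have qlep x : q x <= p x by rewrite (le_trans (qp x)) // tilt_le_self.
exists q; split => //; apply: le_anti; rewrite qlep /=.
by rewrite -lerN2 -(scalar_funN fq) (le_trans (qp _)) // tiltN.
Qed.

End HahnBanach.

(** * Functionals carried by a principal band *)

Section ComponentFunctional.
Context {R : realType} {E : banachLatticeType R}.
Implicit Types (x y u e : E).

(** In the presence of an order continuous norm this is the norm of the component
    of [pospart x] in the band generated by [e], expressed without the band
    projection. *)
Definition component_norm e x : R :=
  sup [set `|(pospart x `&` (t *: e))%O| | t in [set t | 0 <= t]].

Section Component.
Variable e : E.
Hypothesis e0 : 0 <= e.

Lemma trunc_ge0 x (t : R) : 0 <= t -> 0 <= (pospart x `&` (t *: e))%O.
Proof. by move=> t0; rewrite lexI pospart_ge0 bl_scale_ge0. Qed.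

Lemma trunc_norm_le x (t : R) : 0 <= t ->
  `|(pospart x `&` (t *: e))%O| <= `|pospart x|.
Proof. by move=> t0; apply: norm_mono (leIl _ _); exact: trunc_ge0. Qed.

Lemma component_norm_ge x (t : R) : 0 <= t ->
  `|(pospart x `&` (t *: e))%O| <= component_norm e x.
Proof.
move=> t0; apply: ub_le_sup; last by exists t.
by exists `|pospart x| => _ [s s0 <-]; exact: trunc_norm_le.
Qed.

Lemma component_norm_le x b :
  (forall t : R, 0 <= t -> `|(pospart x `&` (t *: e))%O| <= b) ->
  component_norm e x <= b.
Proof.
move=> h; apply: ge_sup; last by move=> _ [t t0 <-]; exact: h.
by exists `|(pospart x `&` (0 *: e))%O|; exists 0 => /=.
Qed.

(** Subadditivity is that of truncation at a fixed multiple of [e]; homogeneity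
    holds because the supremum runs over all multiples. *)
Lemma component_norm_sublinear : sublinear (component_norm e : E -> R).
Proof.
split=> [x y|a x].
  apply: component_norm_le => t t0.
  have te : 0 <= t *: e by exact: bl_scale_ge0.
  apply: (@le_trans _ _
    `|(pospart x `&` (t *: e))%O + (pospart y `&` (t *: e))%O|).
    apply: norm_mono; first exact: trunc_ge0.
    apply: le_trans (bl_meetD_le _ _ te); rewrite ?pospart_ge0 //.
    by rewrite lexI leIr (le_trans (leIl _ _)) // pospartD_le.
  by rewrite (le_trans (ler_normD _ _)) // lerD // component_norm_ge.
rewrite le_eqVlt => /predU1P[<-|a0].
  rewrite scale0r mul0r; apply: component_norm_le => t t0.
  by rewrite (le_trans (trunc_norm_le _ t0)) // ge0_pospart // normr0.
apply: component_norm_le => t t0; rewrite pospartZ //.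
have -> : t *: e = a *: ((a^-1 * t) *: e).
  by rewrite scalerA mulrA divff ?lt0r_neq0 // mul1r.
rewrite -bl_meetZ // normrZ gtr0_norm // ler_pM2l //.
by apply: component_norm_ge; rewrite mulr_ge0 // invr_ge0 ltW.
Qed.

(** Domination by the component norm gives everything else: that norm vanishes on
    negative elements, whence positivity, vanishes on elements disjoint from [e],
    and is at most the norm. *)
Lemma component_functional : exists f : E -> R, [/\
  [/\ scalar f, f e = `|e| & forall x, f x <= component_norm e x],
  forall x, 0 <= x -> 0 <= f x,
  forall x, `|f x| <= `|x| &
  forall x, 0 <= x -> (e `&` x = 0)%O -> f x = 0].
Proof.
have [f [fl fp fe]] := hahn_banach e component_norm_sublinear.
have fpos x : 0 <= x -> 0 <= f x.
  move=> x0; rewrite -oppr_le0 -(scalar_funN fl) (le_trans (fp _)) //.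
  apply: component_norm_le => t t0; rewrite (le_trans (trunc_norm_le _ t0)) //.
  suff -> : pospart (- x) = 0 by rewrite normr0.
  by apply: le_anti; rewrite pospart_ge0 pospart_le bl_oppr_le0 x0 lexx.
have fle x : f x <= `|x|.
  rewrite (le_trans (fp _)) //; apply: component_norm_le => t t0.
  by rewrite (le_trans (trunc_norm_le _ t0)) // norm_pospart.
exists f; split => //.
- split => //; apply: le_anti; rewrite fle /= fe.
  apply: le_trans (component_norm_ge _ ler01).
  by rewrite scale1r ge0_pospart // meetxx.
- by move=> x; rewrite ler_norml fle lerNl -(scalar_funN fl) -[leRHS]normrN fle.
- move=> x x0 ex; apply: le_anti; rewrite fpos // andbT (le_trans (fp _)) //.
  apply: component_norm_le => t t0; rewrite ge0_pospart //.
  by rewrite disjointZ ?normr0 // meetC.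
Qed.

End Component.
End ComponentFunctional.

(** * Diagonal operators *)

Section BoundedCoefficients.
Context {R : realType} {V : completeNormedModType R}.

Variables (w : nat -> V) (M : R).
Hypothesis wM : forall n, `|w n| <= M * (2^-1 ^+ n * 2^-1 ^+ n).

Let h0 n : 0 < (2^-1 ^+ n : R). Proof. by rewrite exprn_gt0 // invr_gt0. Qed.

Let h1 n : (2^-1 ^+ n : R) <= 1.
Proof. by rewrite exprn_ile1 ?invr_ge0 // invf_le1 // ler1n. Qed.

Let M0 : 0 <= M.
Proof. by have := wM 0; rewrite !expr0 !mulr1; exact: le_trans. Qed.

(** Half of the decay of the [w n] is given to the coefficients, the other half
    makes the series converge.  So the sum is controlled by the supremum of the
    [`|c n| * 2^-n].  For bounded [c] all but finitely many of these are
    negligible, whence the continuity of the sum for the product topology. *)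
Lemma coef_geometric (c : nat -> R) (k : R) :
  (forall n, `|c n| * 2^-1 ^+ n <= k) ->
  forall n, `|c n *: w n| <= geometric (k * M) 2^-1 n.
Proof.
move=> ck n; rewrite normrZ /= (le_trans (ler_wpM2l (normr_ge0 _) (wM n))) //.
by rewrite (mulrCA M) [leLHS]mulrA -[leRHS]mulrA ler_wpM2r // mulr_ge0 // ltW.
Qed.

Lemma coef_cvg (c : nat -> R) (k : R) :
  (forall n, `|c n| <= k) -> cvgn (series (fun n => c n *: w n)).
Proof.
move=> ck; apply: (@geometric_cvg _ _ _ (k * M)); apply: coef_geometric => n.
by rewrite (le_trans _ (ck n)) // ler_piMr.
Qed.

Let cube := [set c : nat -> R | forall n, `[-1, 1]%classic (c n)].
Let seqspace := prod_topology (fun _ : nat => R : topologicalType).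

Let cube_compact : compact (cube : set seqspace).
Proof.
apply: (@tychonoff nat (fun=> R) (fun=> `[-1,1]%classic)) => _.
exact: segment_compact.
Qed.

Let cube_sum (c : seqspace) : V := limn (series (fun n => c n *: w n)).

Let cube_sum_continuous : {within (cube : set seqspace), continuous cube_sum}.
Proof.
apply/subspace_continuousP => c cc; apply/cvgrPdist_le => e e0.
pose k := e / (2 * M + 1).
have M1 : 0 < 2 * M + 1 by rewrite ltr_wpDl // mulr_ge0.
have k0 : 0 < k by rewrite divr_gt0.
have [N hN] : exists N, forall n, (N <= n)%N -> 2 * 2^-1 ^+ n <= k.
  have /cvgr0Pnorm_le/(_ k k0) [N _ hN] :
      geometric (2 : R) 2^-1 @ \oo --> (0 : R).
    by apply: cvg_geometric; rewrite ger0_norm ?invr_ge0 // invf_lt1 // ltr1n.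
  exists N => n Nn; apply: le_trans (hN n Nn); exact: ler_norm.
have close : nbhs (c : seqspace)
    [set c' : seqspace | forall i : 'I_N, `|c i - c' i| <= k].
  have FF := nbhs_filter (c : seqspace).
  apply: (@filter_forall seqspace 'I_N
    (fun i => [set c' : seqspace | `|c i - c' i| <= k]) _ FF) => i.
  have /cvgrPdist_le/(_ k k0) := @proj_continuous nat (fun=> R) i c.
  exact.
near=> c'.
have cc' : cube c' by near: c'; exact: withinT.
have cb (d : nat -> R) : cube d -> forall n, `|d n| <= 1.
  by move=> dd n; have := dd n; rewrite /= in_itv /= ler_norml.
have cvc := coef_cvg (cb _ cc); have cvc' := coef_cvg (cb _ cc').
have -> : cube_sum c - cube_sum c' =
    limn (series (fun n => (c n - c' n) *: w n)).
  rewrite -limB //; congr (limn _); apply/funext => n.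
  by rewrite /series fctE /= -sumrB; apply: eq_bigr => i _; rewrite scalerBl.
have kM : 2 * (k * M) <= e.
  rewrite mulrCA /k mulrAC ler_pdivrMr // ler_wpM2l ?(ltW e0) //.
  by rewrite lerDl.
apply: le_trans kM; apply: geometric_norm_lim; apply: coef_geometric => n.
have [nN|Nn] := ltnP n N.
  have ci : forall i : 'I_N, `|c i - c' i| <= k by near: c'; exact: cvg_within.
  by rewrite (le_trans _ (ci (Ordinal nN))) // ler_piMr.
rewrite (le_trans _ (hN n Nn)) // ler_wpM2r ?(ltW (h0 n)) //.
rewrite (le_trans (ler_normB _ _)) // [leRHS](_ : _ = 1 + 1) //.
by rewrite lerD // cb.
Unshelve. all: by end_near. Qed.

Lemma bounded_coef_precompact : precompact (cube_sum @` cube).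
Proof.
apply: compact_precompact; first exact: norm_hausdorff.
have := continuous_compact cube_sum_continuous cube_compact; exact.
Qed.

End BoundedCoefficients.

Section DiagonalOperator.
Context {R : realType} {E : banachLatticeType R}.

(** The unit ball is mapped into the sums of the vectors [4^-n e_n] with
    coefficients in [[-1, 1]]. *)
Lemma diagonal_operator (e : nat -> E) (f : nat -> E -> R) (M : R) :
  (forall n, 0 <= e n) -> (forall n, `|e n| <= M) ->
  (forall n, scalar (f n)) -> (forall n x, `|f n x| <= `|x|) ->
  (forall n x, 0 <= x -> 0 <= f n x) ->
  exists T : {linear E -> E}, [/\ positive_operator T, compact_operator T &
    forall x, series (fun n => f n x *: ((2^-1 ^+ n * 2^-1 ^+ n) *: e n)) @ \oo
      --> T x].
Proof.
move=> e0 eM fl fx fp.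
pose w n : E := (2^-1 ^+ n * 2^-1 ^+ n) *: e n.
have h0 n : 0 <= (2^-1 ^+ n * 2^-1 ^+ n : R).
  by rewrite mulr_ge0 // exprn_ge0 // invr_ge0.
have wM n : `|w n| <= M * (2^-1 ^+ n * 2^-1 ^+ n).
  by rewrite normrZ ger0_norm // mulrC ler_wpM2r.
pose S x := series (fun n => f n x *: w n).
have Sc x : cvgn (S x).
  by apply: (coef_cvg wM (c := f^~ x) (k := `|x|)) => n; exact: fx.
pose T x := limn (S x).
have Tl : linear T.
  move=> a x y; rewrite /T -limZr // -limD //; last exact: is_cvgZr.
  congr (limn _); apply/funext => n; rewrite fctE /=.
  rewrite -[X in _ = X + _]/(a *: S x n) /S /series /= scaler_sumr.
  rewrite -big_split /=; apply: eq_bigr => i _.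
  by rewrite fl scalerDl -scalerA.
pose Tlin := GRing.isLinear.Build R E E *:%R T Tl.
exists (HB.pack T Tlin : {linear E -> E}); split.
- move=> x x0 /=; apply: series_ge0_lim; last exact: Sc.
  by move=> n; rewrite bl_scale_ge0 ?fp // bl_scale_ge0.
- apply: precompact_subset (bounded_coef_precompact wM).
  move=> _ [x x1 <-] /=; exists (f^~ x) => // n.
  by rewrite /= in_itv /= -ler_norml (le_trans (fx _ _)).
- by move=> x; exact: Sc.
Qed.

End DiagonalOperator.

(** * Non-convergent sequences and diagonal operators *)

Section Converse.
Context {R : realType} {E : banachLatticeType R}.

(** The partial sums are eventually constant under [g], and [g] is continuous. *)
Lemma scalar_series_lim (V : normedModType R) (u : nat -> V)
    (g : V -> R) j (l : V) :
  scalar g -> (forall x, `|g x| <= `|x|) -> (forall n, n != j -> g (u n) = 0) ->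
  series u @ \oo --> l -> g l = g (u j).
Proof.
move=> gl gx guj sl.
have gS n : (j < n)%N -> g (series u n) = g (u j).
  move=> jn; rewrite /series /= (big_morph g (scalar_funD gl) (scalar_fun0 gl)).
  by rewrite (bigD1_seq j) ?mem_index_iota ?iota_uniq //= big1 ?addr0.
apply/eqP; rewrite -subr_eq0 -normr_le0; apply/ler_addgt0Pl => d d0.
rewrite addr0; have /cvgrPdist_le/(_ d d0) [N _ hN] := sl.
have := hN (maxn N j.+1) (leq_maxl _ _); apply: le_trans.
by rewrite -(gS (maxn N j.+1)) ?leq_maxr // -scalar_funB.
Qed.

Lemma KB_operators_KB_space (hE : order_continuous_norm E) :
  (forall T : {linear E -> E},
     positive_operator T -> compact_operator T -> KB_operator T) ->
  KB_space E.
Proof.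
move=> opKB x xi x0 xb; apply: contrapT => ncx.
have [M M0 xM] := pinfty_ex_gt0 xb.
have [d [e [m [d0 ex ee de]]]] :=
  disjoint_sequence hE xi x0 (fun n => xM n Logic.I) ncx.
have e0 n : 0 <= e n by case/andP: (ex n).
have eM n : `|e n| <= M.
  by case/andP: (ex n) => _ enx; rewrite (le_trans (norm_mono (e0 n) enx)) ?xM.
have [f hf] := choice (fun n => component_functional (e0 n)).
have fl n : scalar (f n) by case: (hf n) => [[]].
have fe n : f n (e n) = `|e n| by case: (hf n) => [[]].
have fc n y : f n y <= component_norm (e n) y by case: (hf n) => [[]].
have fp n y : 0 <= y -> 0 <= f n y by case: (hf n) => _ + _ _; apply.
have fx n y : `|f n y| <= `|y| by case: (hf n).
have fee n j : n != j -> f j (e n) = 0.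
  case: (hf j) => _ _ _ h nj; apply: h => //.
  by move: nj; rewrite neq_ltn => /orP[] nj; [rewrite meetC ee|rewrite ee].
have [T [Tp Tc TS]] := diagonal_operator e0 eM fl fx fp.
pose c j : R := 2^-1 ^+ j * 2^-1 ^+ j * `|e j|.
have c0 j : 0 < c j.
  by rewrite mulr_gt0 ?mulr_gt0 ?exprn_gt0 ?invr_gt0 // (lt_le_trans d0).
have fT j y : f j (T y) = f j y * c j.
  rewrite (scalar_series_lim (j := j) (fl j) (fx j) _ (TS y)) => [|n nj].
    by rewrite !(scalar_funZ (fl j)) fe.
  by rewrite !(scalar_funZ (fl j)) fee // !mulr0.
have [_ /(_ _ _ x leq_directed xi x0 xb) [y Ty]] := opKB T Tp Tc.
(* [f j] turns the convergence of [T (x i)] to [T y] into that of [f j (x i)] to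
   [f j y], since the factor [c j] is positive; and [f j (x i) >= `|e j| >= d] as
   soon as [m j <= i]. *)
have fy j : d <= f j y.
  rewrite leNgt; apply/negP => yd.
  have g0 : 0 < (d - f j y) * c j by rewrite mulr_gt0 // subr_gt0.
  have FF := tails_properfilter leq_directed.
  have /cvgr0Pnorm_lt/(_ _ g0) [i _ hi] := Ty.
  have /= := hi (maxn i (m j)) (leq_maxl _ _); rewrite normr_id; apply/negP.
  rewrite -leNgt; apply: le_trans (fx j _).
  rewrite (scalar_funB (fl j)) !fT -mulrBl; apply: le_trans (ler_norm _).
  rewrite ler_pM2r // lerD2r (le_trans (de j)) // -fe -subr_ge0 -scalar_funB //.
  rewrite fp // bl_subr_ge0; case/andP: (ex j) => _ /le_trans; apply.
  by rewrite xi // leq_maxr.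
(* The truncations [z j] of the positive part of [y] are disjoint like the
   [e j], so their partial sums [s] remain below the positive part of [y]. *)
have d2 : 0 < d / 2 by rewrite divr_gt0.
have d42 : d / 2 / 2 < d / 2 by rewrite ltr_pdivrMr // ltr_pMr // ltr1n.
have /choice[t ht] : forall j, exists t : R,
    0 <= t /\ d / 2 <= `|(pospart y `&` (t *: e j))%O|.
  move=> j; apply: contrapT => /forallNP h.
  have : f j y <= d / 2.
    apply: le_trans (fc j y) _; apply: component_norm_le => t t0.
    by rewrite leNgt; apply/negP => /ltW ?; apply: (h t).
  apply/negP; rewrite -ltNge; apply: lt_le_trans (fy j).
  by rewrite ltr_pdivrMr // ltr_pMr // ltr1n.
pose z j : E := (pospart y `&` (t j *: e j))%O.
have z0 j : 0 <= z j by apply: trunc_ge0 => //; exact: (ht j).1.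
have zy j : z j <= pospart y by exact: leIl.
have zz j k : (j < k)%N -> (z j `&` z k)%O = 0.
  move=> jk; have [tj _] := ht j; have [tk _] := ht k.
  apply: (disjoint_le (z0 j) (z0 k) (leIr _ _) (leIr _ _)).
  apply: disjointZ => //; first exact: bl_scale_ge0.
  by rewrite meetC disjointZ // meetC ee.
pose s n := \sum_(0 <= j < n) z j.
have si : nondecreasing_seq s.
  move=> i j ij; rewrite /s (big_cat_nat _ ij) //=.
  by rewrite -{1}[\sum_(_ <= _ < i) _]addr0 bl_leD2l bl_sum_ge0.
have [N hN] := order_bounded_cauchy hE si (disjoint_sum_le z0 zy zz)
  (divr_gt0 d2 (ltr0n R 2)).
have := hN N.+1 (leqnSn N); rewrite /s big_nat_recr //= addrAC subrr add0r.
by apply/negP; rewrite -ltNge (lt_le_trans d42) // (ht N).2.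
Qed.

End Converse.

Theorem theorem3 (R : realType) (E : banachLatticeType R)
    (hE : order_continuous_norm E) :
  KB_space E <->
  (forall T : {linear E -> E},
     positive_operator T -> compact_operator T -> KB_operator T).
Proof.
split; last exact: KB_operators_KB_space.
by move=> KB T _; exact: KB_space_operator.
Qed.
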